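(* Let $X_1,\ldots,X_N$ be i.i.d. real-valued discrete-time stochastic processes $X_i=(X_i(t))_{t=0,1,\ldots,T}$ on a probability space $(\Omega,\mathcal F,\mathbb P)$, with $X_i(0)=0$ and with independent increments (for each $i$, the increments $X_i(t+1)-X_i(t)$, $t=0,\ldots,T-1$, are independent). Fix integer observation times $0<t_1<\cdots<t_k=T$ and integer subset sizes $N>n_1>\cdots>n_k=1$. Let $\mathrm{Alg}$ be any iterative selection algorithm and let $\mathrm{Alg}^*$ be the greedy selection algorithm, both with these observation times and subset sizes. Then, whenever both expectations exist, $$\mathbb{E}[\mathrm{Alg}(X_1,\ldots,X_N)]\le \mathbb{E}[\mathrm{Alg}^*(X_1,\ldots,X_N)].$$ That is, the greedy selection algorithm maximizes the expected value of the final selected process.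
   Context: Notation: $[N]=\{1,\ldots,N\}$. Iterative selection algorithm: given observation times $0<t_1<\cdots<t_k=T$ and subset sizes $N>n_1>\cdots>n_k=1$, it consists of $k$ (deterministic, measurable) maps $f_1,\ldots,f_k$ applied successively to a realization of the processes as follows. (i) The map $f_1$ takes the observed history $\mathcal H_1=\{X_i(t)\}_{i\in[N],\,t\le t_1}$ to a subset $\Sigma_1\subset[N]$ with $|\Sigma_1|=n_1$. (ii) For $j>1$, the map $f_j$ takes the updated history $\mathcal H_j=\mathcal H_{j-1}\cup\{X_i(t)\}_{i\in\Sigma_{j-1},\,t_{j-1}<t\le t_j}$ (only the processes still retained are observed further) to a subset $\Sigma_j\subset\Sigma_{j-1}$ with $|\Sigma_j|=n_j$. The final set $\Sigma_k$ has a single element $i_*$, and the value of the algorithm is $\mathrm{Alg}(X_1,\ldots,X_N)=X_{i_*}(T)$. Greedy selection algorithm: the iterative selection algorithm $\mathrm{Alg}^*$ whose selected sets $\Sigma_j^*$ are, with $\Sigma_0^*=[N]$, $$\Sigma_j^*=\{n\in\Sigma_{j-1}^* : X_n(t_j)\text{ is among the } n_j \text{ highest values of } \{X_m(t_j)\}_{m\in\Sigma_{j-1}^*}\},$$ with ties broken by an arbitrary fixed rule (for example, by smallest index) so that $|\Sigma_j^*|=n_j$. Its value $\mathrm{Alg}^*(X_1,\ldots,X_N)$ is $X_{i}(T)$ for the unique $i\in\Sigma_k^*$. *)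

(* Defs.v *)
From HB Require Import structures.
From mathcomp Require Import all_boot all_order all_algebra.
From mathcomp Require Import all_classical all_reals all_analysis.

Set Implicit Arguments.
Unset Strict Implicit.
Unset Printing Implicit Defensive.

Import Order.TTheory GRing.Theory Num.Theory.

Local Open Scope classical_set_scope.
Local Open Scope ring_scope.

Section Probability.
Context {d : measure_display} {Omega : measurableType d} {R : realType}.
Variable P : probability Omega R.

Definition mutually_independent (I : finType) d' (E : measurableType d')
    (Y : I -> Omega -> E) : Prop :=
  forall (J : {set I}) (B : I -> set E),
    (forall i, i \in J -> measurable (B i)) ->
    P [set w | forall i, i \in J -> B i (Y i w)] =
    (\prod_(i in J) P (Y i @^-1` B i))%E.

Definition identically_distributed (I : finType) d' (E : measurableType d')
    (Y : I -> Omega -> E) : Prop :=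
  forall (i j : I) (B : set E), measurable B ->
    P (Y i @^-1` B) = P (Y j @^-1` B).

(* The expectation exists in [-oo, +oo]: E[Y^+] - E[Y^-] is not oo - oo. *)
Definition has_expectation (Y : Omega -> R) : Prop :=
  (\int[P]_w ((EFin \o Y)^\+ w) +? - \int[P]_w ((EFin \o Y)^\- w))%E.

Variables N T : nat.
Variable X : 'I_N -> 'I_T.+1 -> {RV P >-> R}.

Definition sample_path (i : 'I_N) (w : Omega) : T.+1.-tuple R :=
  [tuple X i s w | s < T.+1].

Definition realization (w : Omega) : N.-tuple (T.+1.-tuple R) :=
  [tuple sample_path i w | i < N].

(* X_i(s+1) - X_i(s); lift ord0 s and widen_ord (leqnSn T) s are s+1 and s
   as elements of {0, ..., T}. *)
Definition increment (i : 'I_N) (s : 'I_T) (w : Omega) : R :=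
  X i (lift ord0 s) w - X i (widen_ord (leqnSn T) s) w.

End Probability.

Section Selection.
Variables (R : realType) (N T : nat).

(* Finite family of observed values: None at the (process, time) pairs that
   have not been observed. *)
Definition history := 'I_N -> 'I_T.+1 -> option R.

Definition observe (x : N.-tuple (T.+1.-tuple R))
    (D : {set 'I_N * 'I_T.+1}) : history :=
  fun i s => if (i, s) \in D then Some (tnth (tnth x i) s) else None.

(* t j and n j are meaningful for j <= k only, with the conventions t 0 = 0 and
   n 0 = N.  The maps f 1, ..., f k are the selection maps; f 0 is not used. *)
Variables (k : nat) (t n : nat -> nat) (f : nat -> history -> {set 'I_N}).

(* The set of observed (process, time) pairs after stage j, and Sigma_j, when
   the algorithm runs on x.  With Sigma_0 = [N] and t 0 = 0, the first history
   consists of all the processes up to time t 1. *)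
Fixpoint run (x : N.-tuple (T.+1.-tuple R)) (j : nat) :
    {set 'I_N * 'I_T.+1} * {set 'I_N} :=
  match j with
  | 0%N => ([set p : 'I_N * 'I_T.+1 | p.2 <= t 0]%N%SET, [set: 'I_N]%SET)
  | j'.+1 =>
      let D := ((run x j').1 :|:
        [set p : 'I_N * 'I_T.+1 |
          (p.1 \in (run x j').2) && (t j' < p.2 <= t j'.+1)%N])%SET in
      (D, f j'.+1 (observe x D))
  end.

Definition selected x j : {set 'I_N} := (run x j).2.

(* A history with observed set D is a point of R^D, and the space of histories
   is the disjoint union of the R^D; a map out of it is measurable when, for
   every D, its composition with the projection onto R^D is. *)
Definition measurable_selection (g : history -> {set 'I_N}) : Prop :=
  forall (D : {set 'I_N * 'I_T.+1}) (A : {set 'I_N}),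
    measurable [set x : N.-tuple (T.+1.-tuple R) | g (observe x D) = A].

Definition iterative_selection : Prop :=
  (forall j, (0 < j <= k)%N -> measurable_selection (f j)) /\
  (forall x j, (j < k)%N ->
     selected x j.+1 \subset selected x j /\ #|selected x j.+1| = n j.+1).

(* A consists of m indices of S carrying the m highest values of v on S; when
   values are tied there may be several such A. *)
Definition highest (m : nat) (S : {set 'I_N}) (v : 'I_N -> R)
    (A : {set 'I_N}) : Prop :=
  [/\ A \subset S, #|A| = m &
      forall a b, a \in A -> b \in S -> b \notin A -> v b <= v a].

(* No tie-breaking rule is singled out: any rule that makes f an iterative
   selection algorithm is allowed. *)
Definition greedy_selection : Prop :=
  iterative_selection /\
  (forall x j, (j < k)%N ->
     highest (n j.+1) (selected x j)
       (fun i => tnth (tnth x i) (inord (t j.+1))) (selected x j.+1)).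

(* X_{i_*}(T) for the unique element i_* of Sigma_k; the default 0 is not
   reached by an iterative selection algorithm with n k = 1. *)
Definition alg_value (x : N.-tuple (T.+1.-tuple R)) : R :=
  if [pick i in selected x k] is Some i then tnth (tnth x i) ord_max else 0.

End Selection.

(* Main.v *)
Require Import Defs.
From HB Require Import structures.
From mathcomp Require Import all_boot all_order all_algebra.
From mathcomp Require Import all_classical all_reals all_analysis.
From mathcomp Require Import measurable_realfun perm.
Import Order.TTheory GRing.Theory Num.Theory.
Local Open Scope ring_scope.

(** The greedy value stochastically dominates the value of every other
    algorithm: for every nondecreasing utility [phi >= 0], the greedy algorithm
    maximizes the expectation of [phi] of the final value.  The expected values
    are then compared by applying this to the indicators of the rays
    ]r, +oo[ and writing an expectation as a difference of integrals of tail
    probabilities ([expectation_tails]).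

    The maximization is a dynamic programming argument.  Let
    [optimal_value m j S v] be the best expected utility when stage j is over,
    m stages remain, S is the set of retained processes and v the vector of
    their current values.  By independence of the increments, what happens
    between the observation times t_j and t_{j+1} is independent of everything
    observed so far ([past_future_independent]), so that the state (S, v)
    summarizes the past and the expectation of the optimal value of the state
    cannot increase along the run of an algorithm ([stage_value_le]).  It is
    preserved when each selection attains the maximum.

    The greedy selection does.  The gains of the N processes over a period are
    exchangeable, hence the optimal value depends on the retained values as a
    multiset, and it is nondecreasing in each of them because [phi] is: this is
    the single statement [optimal_value_perm].  Any set of n_{j+1} retained
    processes can be turned into the set of the n_{j+1} highest ones by
    exchanging processes for processes of at least the same value, and no
    exchange decreases the optimal value ([optimal_value_highest]).

    Both algorithms start in the same state, so the expected utility of the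
    greedy algorithm is the optimal value of that state, which bounds the
    expected utility of the other one. *)

Set Implicit Arguments.
Unset Strict Implicit.
Unset Printing Implicit Defensive.
Local Open Scope classical_set_scope.

(** * Independence of disjoint blocks of a family *)

(** The events that restrict the coordinates [Y i], [i] in [J], to a box.  They
    form a pi-system generating the sigma-algebra of [(Y i)_(i in J)]; taking
    all the [B i] measurable, also those outside [J], loses no box. *)
Definition cylinders (I : finType) (U : Type) d (E : measurableType d)
    (Y : I -> U -> E) (J : {set I}) : set (set U) :=
  [set A | exists2 B : I -> set E, (forall i, measurable (B i)) &
           A = [set w | forall i, i \in J -> B i (Y i w)]].

Lemma measurable_forall (I : finType) d (U : measurableType d) (p : pred I)
    (A : I -> set U) :
  (forall i, p i -> measurable (A i)) ->
  measurable [set w | forall i, p i -> A i w].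
Proof.
move=> mA.
have -> : [set w | forall i, p i -> A i w] =
          \big[setI/setT]_(i <- index_enum I | p i) A i.
  apply/seteqP; split => w; rewrite -bigcap_seq_cond.
    by move=> Aw i /= /andP[_ /Aw].
  by move=> Aw i pi; apply: Aw; rewrite /= mem_index_enum.
exact: bigsetI_measurable.
Qed.

Section cylinders_theory.
Context (I : finType) d (U : measurableType d) d' (E : measurableType d').
Variable Y : I -> U -> E.
Implicit Types J K : {set I}.

Lemma cylinders_measurable J : (forall i, i \in J -> measurable_fun setT (Y i)) ->
  cylinders Y J `<=` measurable.
Proof.
move=> mY A [B mB ->].
apply: (@measurable_forall _ _ _ (fun i => i \in J) (fun i => Y i @^-1` B i)).
by move=> i iJ; rewrite -[X in measurable X]setTI; exact: mY.
Qed.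

Lemma cylinders_setI_closed J : setI_closed (cylinders Y J).
Proof.
move=> _ _ [B mB ->] [C mC ->]; exists (fun i => B i `&` C i).
  by move=> i; exact: measurableI.
apply/seteqP; split=> w /=.
  by move=> [hB hC] i iJ; split; [exact: hB|exact: hC].
by move=> h; split=> i iJ; have [] := h i iJ.
Qed.

Lemma cylindersT J : cylinders Y J setT.
Proof. by exists (fun=> setT) => //; apply/seteqP; split. Qed.

(** Stated over the type [U] equipped with the generated sigma-algebra, so that
    the measurability of anything computed from these coordinates follows from
    the closure properties of measurable functions. *)
Lemma cylinders_coordinate J i : i \in J ->
  measurable_fun setT (Y i : g_sigma_algebraType (cylinders Y J) -> E).
Proof.
move=> iJ _ B mB; rewrite setTI; apply: sub_sigma_algebra.
exists (fun j => if j == i then B else setT) => [j|].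
  by case: eqP => // _; exact: measurableT.
apply/seteqP; split=> [w /= Bw j jJ|w /= /(_ _ iJ)]; last by rewrite eqxx.
by case: eqP => // ->.
Qed.

End cylinders_theory.

(** The uniqueness of finite measures that agree on a pi-system. *)
Lemma eq_measure_cylinders (R : realType) (I : finType) d (U : measurableType d)
    d' (E : measurableType d') (Y : I -> U -> E) (J : {set I})
    (m1 m2 : {measure set U -> \bar R}) :
  (forall i, i \in J -> measurable_fun setT (Y i)) ->
  (m1 setT < +oo)%E ->
  (forall A, cylinders Y J A -> m1 A = m2 A) ->
  forall A, <<s cylinders Y J >> A -> m1 A = m2 A.
Proof.
move=> mY m1oo m12; apply: (g_sigma_algebra_measure_unique _ _ (fun=> setT)) => //.
- exact: cylinders_measurable.
- by move=> _; exact: cylindersT.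
- by rewrite bigcup_const.
- exact: cylinders_setI_closed.
Qed.

Section independence.
Local Open Scope ereal_scope.
Context d (Omega : measurableType d) (R : realType) (P : probability Omega R).

Section disjoint_blocks.
Context (I : finType) d' (E : measurableType d') (Y : I -> Omega -> E).
Hypothesis mY : forall i, measurable_fun setT (Y i).
Hypothesis Y_indep : mutually_independent P Y.
Variables J K : {set I}.
Hypothesis JK : [disjoint J & K]%B.

Lemma independent_cylinders A B : cylinders Y J A -> cylinders Y K B ->
  P (A `&` B) = P A * P B.
Proof.
move=> [A' mA' ->] [B' mB' ->].
pose C i := if i \in J then A' i else B' i.
have mC i : measurable (C i) by rewrite /C; case: ifP.
have -> : [set w | forall i, i \in J -> A' i (Y i w)] `&`
          [set w | forall i, i \in K -> B' i (Y i w)] =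
          [set w | forall i, i \in J :|: K -> C i (Y i w)].
  apply/seteqP; split=> w /=.
    move=> [hA hB] i; rewrite inE /C; case: ifP => [/hA //|_ /=]; exact: hB.
  move=> h; split=> i iJK.
    by have := h i; rewrite /C inE iJK => /(_ isT).
  by have := h i; rewrite /C inE iJK orbT (disjointFl JK iJK) => /(_ isT).
rewrite !Y_indep //.
rewrite (eq_bigl [in [predU J & K]]) => [|i]; last by rewrite !inE.
rewrite bigU //=; congr (_ * _); apply: eq_bigr => i iJK; rewrite /C.
  by rewrite iJK.
by rewrite (disjointFl JK iJK).
Qed.

(** Independence passes from the boxes to the generated sigma-algebras one
    factor at a time: with [D] fixed, [C |-> P (C `&` D)] and [C |-> P C * P D]
    are finite measures that agree on a pi-system. *)
Lemma independent_disjoint_blocks A B :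
  <<s cylinders Y J >> A -> <<s cylinders Y K >> B -> P (A `&` B) = P A * P B.
Proof.
have sub L : <<s cylinders Y L >> `<=` measurable.
  apply: smallest_sub; first exact: sigma_algebra_measurable.
  by apply: cylinders_measurable => i _; exact: mY.
pose scale (C : set Omega) : {nonneg R} := NngNum (fine_ge0 (measure_ge0 P C)).
have scaleE (C D : set Omega) (mC : measurable C) :
    mscale (scale C) P D = P D * P C.
  by rewrite /mscale/= fineK ?fin_num_measure// muleC.
have restrE (C D : set Omega) (mC : measurable C) :
    mrestr P mC D = P (D `&` C).
  by [].
have restr_oo (C : set Omega) (mC : measurable C) : mrestr P mC setT < +oo.
  by rewrite restrE setTI; exact: le_lt_trans (probability_le1 P mC) (ltry 1).
have step1 C D : <<s cylinders Y J >> C -> cylinders Y K D ->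
    P (C `&` D) = P C * P D.
  move=> sC kD; have mD : measurable D by apply: (sub K); exact: sub_sigma_algebra.
  rewrite -(scaleE D C) // -(restrE D C mD).
  apply: (@eq_measure_cylinders R I _ _ _ _ Y J) => //.
    exact: (restr_oo D mD).
  move=> C' jC'; apply: etrans (esym (scaleE D C' mD)).
  exact: independent_cylinders.
move=> sA sB; have mA : measurable A by exact: (sub J).
rewrite setIC muleC -(scaleE A B) // -(restrE A B mA).
apply: (@eq_measure_cylinders R I _ _ _ _ Y K) => //.
  exact: (restr_oo A mA).
move=> B' kB'; apply: etrans (esym (scaleE A B' mA)).
by rewrite [LHS]restrE setIC muleC step1.
Qed.

End disjoint_blocks.

(** The law of an independent pair is the product of the laws, so by Tonelli the
    second component may be resampled independently of the first one. *)
Lemma integral_independent_pair d1 d2 (E1 : measurableType d1)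
    (E2 : measurableType d2) (U : Omega -> E1) (V : Omega -> E2)
    (h : E1 * E2 -> \bar R) :
  measurable_fun setT U -> measurable_fun setT V ->
  (forall A B, measurable A -> measurable B ->
    P (U @^-1` A `&` V @^-1` B) = P (U @^-1` A) * P (V @^-1` B)) ->
  measurable_fun setT h -> (forall z, 0 <= h z) ->
  \int[P]_w h (U w, V w) = \int[P]_w \int[P]_w' h (U w, V w').
Proof.
move=> mU mV UV mh h0.
have mUV : measurable_fun setT (fun w => (U w, V w)) by exact: measurable_fun_pair.
pose PU : probability _ R := distribution P (mfun_Sub (mem_set mU)).
pose PV : probability _ R := distribution P (mfun_Sub (mem_set mV)).
pose PUV : probability _ R := distribution P (mfun_Sub (mem_set mUV)).
have prodE A : measurable A -> (PU \x PV) A = PUV A.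
  by apply: product_measure_unique => B C mB mC; exact: UV.
transitivity (\int[PUV]_z h z).
  by rewrite ge0_integral_pushforward.
transitivity (\int[PU \x PV]_z h z).
  by apply: eq_measure_integral => A mA _; exact/esym/prodE.
rewrite fubini_tonelli1 // /fubini_F ge0_integral_pushforward //=; last 2 first.
- exact: measurable_fun_fubini_tonelli_F.
- by move=> x _; exact: integral_ge0.
apply: eq_integral => w _.
rewrite ge0_integral_pushforward //.
exact: measurableT_comp.
Qed.

Lemma measurable_tuple_map n d' (E : measurableType d') d1 (U : measurableType d1)
    (Y : 'I_n -> U -> E) :
  (forall i, measurable_fun setT (Y i)) ->
  measurable_fun setT (fun w => [tuple Y i w | i < n]).
Proof.
move=> mY; apply/measurable_fun_tnthP => i.
by rewrite (_ : _ \o _ = Y i) //; apply/funext => w /=; rewrite tnth_mktuple.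
Qed.

Lemma measurable_tuple_cylinders n d' (E : measurableType d') :
  @measurable _ (n.-tuple E) `<=`
  <<s cylinders (fun (i : 'I_n) (u : n.-tuple E) => tnth u i) [set: 'I_n]%SET >>.
Proof.
pose Y (i : 'I_n) (u : n.-tuple E) := tnth u i.
have mid : measurable_fun setT
    (idfun : g_sigma_algebraType (cylinders Y [set: 'I_n]%SET) -> n.-tuple E).
  by apply/measurable_fun_tnthP => i; apply: cylinders_coordinate; rewrite inE.
by move=> A mA; have := mid measurableT A mA; rewrite setTI.
Qed.

(** The two tuples give every box the same probability, the product being
    reindexed by [s]. *)
Lemma exchangeable_iid n d' (E : measurableType d') (Y : 'I_n -> Omega -> E)
    (s : {perm 'I_n}) (B : set (n.-tuple E)) :
  (forall i, measurable_fun setT (Y i)) ->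
  mutually_independent P Y -> identically_distributed P Y -> measurable B ->
  P [set w | B [tuple Y (s i) w | i < n]] = P [set w | B [tuple Y i w | i < n]].
Proof.
move=> mY Yi Yd mB.
have mY1 := measurable_tuple_map mY.
have mY2 := measurable_tuple_map (fun i => mY (s i)).
pose m1 : probability _ R := distribution P (mfun_Sub (mem_set mY1)).
pose m2 : probability _ R := distribution P (mfun_Sub (mem_set mY2)).
suff : m2 B = m1 B by [].
apply: (@eq_measure_cylinders R _ _ _ _ _
  (fun (i : 'I_n) (u : n.-tuple E) => tnth u i) [set: 'I_n]%SET).
- by move=> i _; exact: measurable_tnth.
- exact: le_lt_trans (probability_le1 m2 measurableT) (ltry 1).
- move=> _ [C mC ->].
  have E1 : m1 [set u | forall i, i \in [set: 'I_n]%SET -> C i (tnth u i)] =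
      P [set w | forall i, i \in [set: 'I_n]%SET -> C i (Y i w)].
    by congr (P _); apply/seteqP; split=> w /= h i iT; have := h i iT;
      rewrite tnth_mktuple.
  have E2 : m2 [set u | forall i, i \in [set: 'I_n]%SET -> C i (tnth u i)] =
      P [set w | forall i, i \in [set: 'I_n]%SET -> C (s^-1%g i) (Y i w)].
    congr (P _); apply/seteqP; split=> w /= h i iT.
      by have := h (s^-1%g i); rewrite inE tnth_mktuple permKV => /(_ isT).
    by have := h (s i); rewrite inE tnth_mktuple permK => /(_ isT).
  apply: (etrans E2); apply: (etrans _ (esym E1)).
  rewrite (Yi _ (fun i => C (s^-1%g i))) // (Yi _ C) //.
  rewrite [RHS](reindex_inj (@perm_inj _ s^-1%g)) /=.
  by apply: eq_big => i; [rewrite !inE|move=> _; exact: Yd].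
- exact: measurable_tuple_cylinders.
Qed.

End independence.

(** * The optimal value and its monotonicity *)

Lemma measurable_bigmaxe (R : realType) d (U : measurableType d) (I : Type)
    (r : seq I) (p : pred I) (h : I -> U -> \bar R) :
  (forall i, p i -> measurable_fun setT (h i)) ->
  measurable_fun setT (fun u => \big[maxe/0%E]_(i <- r | p i) h i u).
Proof.
move=> mh; elim: r => [|i r IHr].
  by under eq_fun do rewrite big_nil; exact: measurable_cst.
under eq_fun do rewrite big_cons.
by case pi: (p i) => //; apply: measurable_maxe => //; exact: mh.
Qed.

Section optimal_value.
Local Open Scope ereal_scope.
Context d (Omega : measurableType d) (R : realType) (P : probability Omega R).
Variables (N : nat) (n : nat -> nat).
Variable phi : R -> \bar R.
Hypothesis mphi : measurable_fun setT phi.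
Hypothesis phi_nd : forall r s : R, (r <= s)%R -> phi r <= phi s.

Definition add_values (u v : N.-tuple R) : N.-tuple R :=
  [tuple tnth u i + tnth v i | i < N]%R.

Variable gain : nat -> Omega -> N.-tuple R.
Hypothesis mgain : forall j, measurable_fun setT (gain j).
Hypothesis gain_exchangeable : forall j (s : {perm 'I_N}) (B : set (N.-tuple R)),
  measurable B ->
  P [set w | B [tuple tnth (gain j w) (s i) | i < N]] = P [set w | B (gain j w)].

(** The backward induction formula of optimal control: the value before a period
    is the expectation over its gains of the best choice after it.  The default
    0 of the maxima does not alter a maximum of nonnegative utilities. *)
Fixpoint optimal_value (m j : nat) (S : {set 'I_N}) (v : N.-tuple R) : \bar R :=
  match m with
  | 0%N => \big[maxe/0]_(i in S) phi (tnth v i)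
  | m'.+1 => \int[P]_w
      \big[maxe/0]_(A : {set 'I_N} | (A \subset S) && (#|A| == n j.+1))
        optimal_value m' j.+1 A (add_values v (gain j w))
  end.

Definition best_choice (m j : nat) (S : {set 'I_N}) (v : N.-tuple R) : \bar R :=
  \big[maxe/0]_(A : {set 'I_N} | (A \subset S) && (#|A| == n j.+1))
    optimal_value m j.+1 A v.

Lemma best_choice_ge0 m j S v : 0 <= best_choice m j S v.
Proof. exact: bigmax_ge_id. Qed.

Lemma optimal_value_ge0 m j S v : 0 <= optimal_value m j S v.
Proof.
case: m => [|m] /=; first exact: bigmax_ge_id.
by apply: integral_ge0 => w _; exact: best_choice_ge0.
Qed.

Lemma measurable_add_values d1 (U : measurableType d1) (u v : U -> N.-tuple R) :
  measurable_fun setT u -> measurable_fun setT v ->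
  measurable_fun setT (fun x => add_values (u x) (v x)).
Proof.
move=> mu mv; apply: measurable_tuple_map => i.
apply: measurable_funD.
  exact: (measurableT_comp (@measurable_tnth _ R N i) mu).
exact: (measurableT_comp (@measurable_tnth _ R N i) mv).
Qed.

Lemma measurable_optimal_value m j S : measurable_fun setT (optimal_value m j S).
Proof.
elim: m j S => [|m IHm] j S.
  apply: measurable_bigmaxe => i _.
  exact: (measurableT_comp mphi (@measurable_tnth _ R N i)).
pose h (z : N.-tuple R * Omega) := best_choice m j S (add_values z.1 (gain j z.2)).
apply: (@measurable_fun_fubini_tonelli_F _ _ _ _ _ P h).
- apply: measurable_bigmaxe => A _; apply: measurableT_comp; first exact: IHm.
  apply: measurable_add_values => //; exact: measurableT_comp.
- by move=> z; exact: best_choice_ge0.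
Qed.

Lemma measurable_best_choice m j S : measurable_fun setT (best_choice m j S).
Proof. by apply: measurable_bigmaxe => A _; exact: measurable_optimal_value. Qed.

Lemma integral_gain_perm j (s : {perm 'I_N}) (h : N.-tuple R -> \bar R) :
  measurable_fun setT h -> (forall v, 0 <= h v) ->
  \int[P]_w h [tuple tnth (gain j w) (s i) | i < N] = \int[P]_w h (gain j w).
Proof.
move=> mh h0.
have mpgain : measurable_fun setT (fun w => [tuple tnth (gain j w) (s i) | i < N]).
  apply: measurable_tuple_map => i.
  exact: (measurableT_comp (@measurable_tnth _ R N (s i)) (mgain j)).
transitivity (\int[distribution P (mfun_Sub (mem_set mpgain))]_v h v).
  by rewrite ge0_integral_pushforward.
transitivity (\int[distribution P (mfun_Sub (mem_set (mgain j)))]_v h v).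
  by apply: eq_measure_integral => B mB _; exact: gain_exchangeable.
by rewrite ge0_integral_pushforward.
Qed.

(** Permuting the processes by [s] permutes their gains, which does not change
    the law of the gains; monotonicity is proved together with this symmetry so
    that the two survive the induction step as one hypothesis. *)
Lemma optimal_value_perm m j (s : {perm 'I_N}) (S : {set 'I_N})
    (v v' : N.-tuple R) :
  (forall i, i \in S -> (tnth v i <= tnth v' (s i))%R) ->
  optimal_value m j S v <= optimal_value m j (s @: S)%SET v'.
Proof.
elim: m j S v v' => [|m IHm] j S v v' vv' /=.
  apply: bigmax_le => [|i iS]; first exact: bigmax_ge_id.
  apply: (le_trans (phi_nd (vv' i iS))).
  by apply: (@le_bigmax_cond _ _ _ 0 (s i)); rewrite imset_f.
have mh u S' : measurable_fun setT (fun g => best_choice m j S' (add_values u g)).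
  apply: measurableT_comp; first exact: measurable_best_choice.
  exact: measurable_add_values.
(* Process [i] on the left receives the same gain as process [s i] on the
   right. *)
rewrite -[leRHS](@integral_gain_perm j s^-1%g
  (fun g => best_choice m j (s @: S)%SET (add_values v' g))); last 2 first.
- exact: mh.
- by move=> g; exact: best_choice_ge0.
apply: ge0_le_integral => //.
- by move=> w _; exact: bigmax_ge_id.
- exact: (measurableT_comp (mh v S) (mgain j)).
- apply: (measurableT_comp (mh v' _)); apply: measurable_tuple_map => i.
  exact: (measurableT_comp (@measurable_tnth _ R N _) (mgain j)).
move=> w _; apply: bigmax_le => [|A /andP[AS nA]]; first exact: best_choice_ge0.
apply: (@le_trans _ _ (optimal_value m j.+1 (s @: A)%SET
  (add_values v' [tuple tnth (gain j w) (s^-1%g i) | i < N]))).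
  apply: IHm => i iA; rewrite !tnth_mktuple permK lerD2r vv' //.
  exact: (fintype.subsetP AS).
apply: (@le_bigmax_cond _ _ _ 0 (s @: A)%SET).
by rewrite imsetS // card_imset //; exact: perm_inj.
Qed.

(** Exchange argument, by induction on the number of elements of [B] outside
    [A]: a [b] in [B] but not in [A] is replaced by an [a] in [A] but not in [B],
    whose value is at least as high. *)
Lemma optimal_value_highest m j k (S : {set 'I_N}) v A (B : {set 'I_N}) :
  highest k S (tnth v) A -> B \subset S -> #|B| = k ->
  optimal_value m j B v <= optimal_value m j A v.
Proof.
move=> [AS cA hA]; have [c] := ubnP #|B :\: A|%SET.
elim: c B => // c IHc B ltc BS cB.
have cBA : #|A :\: B|%SET = #|B :\: A|%SET.
  by rewrite !cardsD cA cB finset.setIC.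
have [BA0|[b]] := set_0Vmem (B :\: A)%SET.
  suff -> : A = B by [].
  have BA : B \subset A by rewrite -finset.setD_eq0 BA0.
  by apply/esym/eqP; rewrite eqEcard BA cA cB /=.
rewrite inE => /andP[bA bB].
have [AB0|[a]] := set_0Vmem (A :\: B)%SET.
  have : b \in (B :\: A)%SET by rewrite inE bA.
  by move/eqP: cBA; rewrite AB0 cards0 eq_sym cards_eq0 => /eqP->; rewrite inE.
rewrite inE => /andP[aB aA].
apply: (@le_trans _ _ (optimal_value m j (tperm b a @: B)%SET v)).
  apply: optimal_value_perm => i iB; case: tpermP => [->|ia|//].
    by apply: hA => //; exact: (fintype.subsetP BS).
  by rewrite -ia iB in aB.
apply: IHc.
- apply: (@leq_trans #|B :\: A|%SET); last by rewrite -ltnS.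
  apply: proper_card. apply/fintype.properP. split.
    apply/fintype.subsetP => i; rewrite !inE => /andP[iA /imsetP[x xB ix]].
    rewrite iA /= ix; case: tpermP ix => [_ ia|//|//].
    by rewrite ia aA in iA.
  exists b; first by rewrite inE bA.
  rewrite !inE bA /=; apply/imsetP => -[x xB bx].
  move: bx aB; rewrite -{1}(tpermR b a) => /perm_inj ->; by rewrite xB.
- apply/fintype.subsetP => i /imsetP[x xB ->]; by case: tpermP => *; [exact: (fintype.subsetP AS)|exact: (fintype.subsetP BS)..].
- by rewrite card_imset //; exact: perm_inj.
Qed.

End optimal_value.

(** * Measurability and causality of the selections *)

(** Selections take finitely many values, so a quantity depending on a selection
    is measurable as soon as it is for each fixed outcome of the selection. *)
Lemma measurable_fun_dispatch (F : finType) d1 (U : measurableType d1) d2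
    (V : measurableType d2) (sel : U -> F) (h : F -> U -> V) :
  (forall a, measurable [set u | sel u = a]) ->
  (forall a, measurable_fun setT (h a)) ->
  measurable_fun setT (fun u => h (sel u) u).
Proof.
move=> msel mh _ B mB; rewrite setTI.
have -> : (fun u => h (sel u) u) @^-1` B =
    \big[setU/set0]_(a <- index_enum F) ([set u | sel u = a] `&` h a @^-1` B).
  apply/seteqP; split=> u; rewrite -bigcup_seq.
    by move=> Bu; exists (sel u) => //=; rewrite mem_index_enum.
  by move=> [a _ [/= <-]].
apply: bigsetU_measurable => a _; apply: measurableI => //.
by rewrite -[X in measurable X]setTI; exact: mh.
Qed.

Section run_theory.
Context (R : realType) (N T : nat).
Variables (k : nat) (t : nat -> nat) (f : nat -> history R N T -> {set 'I_N}).
Hypothesis t_incr : forall j : nat, (j < k)%N -> (t j < t j.+1)%N.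

Implicit Type x : N.-tuple (T.+1.-tuple R).

(** The paths frozen at time [s]: a function of the past up to [s] that lives
    in the same space as the whole realization, so that the algorithms can be
    run on it. *)
Definition stopped (s : nat) x : N.-tuple (T.+1.-tuple R) :=
  [tuple [tuple tnth (tnth x i) (inord (minn u s)) | u < T.+1] | i < N].

Definition values_at (s : nat) x : N.-tuple R :=
  [tuple tnth (tnth x i) (inord s) | i < N].

Lemma stoppedE s x i (u : 'I_T.+1) :
  (u <= s)%N -> tnth (tnth (stopped s x) i) u = tnth (tnth x i) u.
Proof. by move=> us; rewrite !tnth_mktuple (minn_idPl us) inord_val. Qed.

Lemma run_observed x j p : (j <= k)%N -> p \in (run t f x j).1 -> (p.2 <= t j)%N.
Proof.
elim: j p => [|j IHj] p jk /=; first by rewrite inE.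
rewrite !inE => /orP[/IHj|/and3P[]//].
by move=> /(_ (ltnW jk)) pj; rewrite (leq_trans pj) // ltnW // t_incr.
Qed.

(** Causality: up to stage [j] only values at times at most [t j] are observed. *)
Lemma run_stopped x j s : (j <= k)%N -> (t j <= s)%N ->
  run t f (stopped s x) j = run t f x j.
Proof.
elim: j => // j IHj jk tjs.
have E : run t f (stopped s x) j = run t f x j.
  by apply: IHj; [exact: ltnW|rewrite (leq_trans _ tjs) // ltnW // t_incr].
have obsE (D : {set 'I_N * 'I_T.+1}) : (forall p, p \in D -> (p.2 <= s)%N) ->
    observe (stopped s x) D = observe x D.
  move=> Ds; apply/funext => i; apply/funext => u; rewrite /observe.
  by case: ifP => // /Ds us; rewrite stoppedE.
rewrite /= E obsE // => p pD.
by apply: leq_trans tjs; apply: (@run_observed x).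
Qed.

Lemma values_at_stopped s x : (s <= T)%N -> values_at s (stopped s x) = values_at s x.
Proof.
move=> sT; apply: eq_from_tnth => i.
by rewrite !tnth_mktuple inordK // minnn.
Qed.

Lemma measurable_values_at s : measurable_fun setT (values_at s).
Proof.
apply: measurable_tuple_map => i.
exact: (measurableT_comp (@measurable_tnth _ _ _ _) (@measurable_tnth _ _ _ _)).
Qed.

Lemma measurable_stopped s : measurable_fun setT (stopped s).
Proof.
apply: measurable_tuple_map => i; apply: measurable_tuple_map => u.
exact: (measurableT_comp (@measurable_tnth _ _ _ _) (@measurable_tnth _ _ _ _)).
Qed.

Hypothesis f_meas : forall j, (0 < j <= k)%N -> measurable_selection (f j).

(** Conditionally on the state after stage [j], which has finitely many possible
    values, the next observed set is fixed and the measurability of the selection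
    map applies. *)
Lemma measurable_run j q : (j <= k)%N -> measurable [set x | run t f x j = q].
Proof.
elim: j q => [|j IHj] q jk /=.
  set q0 := ([set _ | _]%SET, _).
  have [<-|/eqP q0q] := eqVneq q0 q.
    by rewrite (_ : [set _ | _] = setT) //; apply/seteqP.
  by rewrite (_ : [set _ | _] = set0) //; apply/seteqP; split.
pose D (q' : {set 'I_N * 'I_T.+1} * {set 'I_N}) := (q'.1 :|:
  [set p : 'I_N * 'I_T.+1 | (p.1 \in q'.2) && (t j < p.2 <= t j.+1)%N])%SET.
rewrite (_ : [set _ | _] = \big[setU/set0]_(q' <- index_enum _)
    ([set x | run t f x j = q'] `&`
     [set x | (D q', f j.+1 (observe x (D q'))) = q])); last first.
  apply/seteqP; split=> x; rewrite -bigcup_seq.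
    by move=> xq; exists (run t f x j) => //=; rewrite mem_index_enum.
  by move=> [q' _ [/= <-]].
apply: bigsetU_measurable => q' _; apply: measurableI; first exact: IHj (ltnW jk).
case: q => D0 A0.
have [<-|DD0] := eqVneq (D q') D0.
  rewrite (_ : [set _ | _] = [set x | f j.+1 (observe x (D q')) = A0]).
    exact: f_meas.
  by apply/seteqP; split=> x /= => [[]|->].
rewrite (_ : [set _ | _] = set0) //.
by apply/seteqP; split=> x //= [/eqP]; rewrite (negbTE DD0).
Qed.

Lemma measurable_selected j A : (j <= k)%N ->
  measurable [set x | selected t f x j = A].
Proof.
move=> jk; rewrite (_ : [set _ | _] = \big[setU/set0]_(D <- index_enum _)
    [set x | run t f x j = (D, A)]).
  by apply: bigsetU_measurable => D _; exact: measurable_run.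
apply/seteqP; split=> x; rewrite -bigcup_seq /selected /=.
  by move=> <-; exists (run t f x j).1; rewrite /= ?mem_index_enum // -surjective_pairing.
by move=> [D _ /= ->].
Qed.

End run_theory.

(** * Past and future of the processes *)

Section processes.
Local Open Scope ereal_scope.
Context d (Omega : measurableType d) (R : realType) (P : probability Omega R).
Variables (N T : nat) (X : 'I_N -> 'I_T.+1 -> {RV P >-> R}).

Lemma mutually_independent_comp (I : finType) d1 (E1 : measurableType d1)
    d2 (E2 : measurableType d2) (Y : I -> Omega -> E1) (h : E1 -> E2) :
  measurable_fun setT h -> mutually_independent P Y ->
  mutually_independent P (fun i w => h (Y i w)).
Proof.
move=> mh Yi J B mB; apply: (Yi J (fun i => h @^-1` B i)) => i iJ.
by rewrite -[X in measurable X]setTI; apply: mh => //; exact: mB.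
Qed.

Lemma identically_distributed_comp (I : finType) d1 (E1 : measurableType d1)
    d2 (E2 : measurableType d2) (Y : I -> Omega -> E1) (h : E1 -> E2) :
  measurable_fun setT h -> identically_distributed P Y ->
  identically_distributed P (fun i w => h (Y i w)).
Proof.
move=> mh Yd i j B mB; apply: (Yd i j (h @^-1` B)).
by rewrite -[X in measurable X]setTI; exact: mh.
Qed.

Lemma measurable_sample_path i : measurable_fun setT (sample_path X i).
Proof. by apply: measurable_tuple_map => s. Qed.

Lemma measurable_realization : measurable_fun setT (realization X).
Proof. by apply: measurable_tuple_map => i; exact: measurable_sample_path. Qed.

Lemma tnth_realization w i s : tnth (tnth (realization X w) i) s = X i s w.
Proof. by rewrite !tnth_mktuple. Qed.

Hypothesis X_indep : mutually_independent P (sample_path X).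
Hypothesis X_ident : identically_distributed P (sample_path X).
Hypothesis X0 : forall (i : 'I_N) (w : Omega), X i ord0 w = 0%R.
Hypothesis incr_indep : forall i : 'I_N, mutually_independent P (increment X i).

Definition increments (p : 'I_N * 'I_T) : Omega -> R := increment X p.1 p.2.

Lemma measurable_increments p : measurable_fun setT (increments p).
Proof. by apply: measurable_funB. Qed.

(** Independence across processes, then across time within each process: the
    probability of a box factors first over [i], then over [r]. *)
Lemma increments_independent : mutually_independent P increments.
Proof.
move=> J B mB.
pose C i : set (T.+1.-tuple R) := [set x | forall r : 'I_T, (i, r) \in J ->
  B (i, r) (tnth x (lift ord0 r) - tnth x (widen_ord (leqnSn T) r))%R].
have mC i : measurable (C i).
  apply: (@measurable_forall _ _ _ (fun r => (i, r) \in J)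
    (fun r => [set x | B (i, r)
      (tnth x (lift ord0 r) - tnth x (widen_ord (leqnSn T) r))%R])) => r irJ.
  have mr : measurable_fun setT (fun x : T.+1.-tuple R =>
      (tnth x (lift ord0 r) - tnth x (widen_ord (leqnSn T) r))%R).
    by apply: measurable_funB; exact: measurable_tnth.
  by have := mr measurableT _ (mB _ irJ); rewrite setTI.
have -> : [set w | forall p, p \in J -> B p (increments p w)] =
    [set w | forall i, i \in [set: 'I_N]%SET -> C i (sample_path X i w)].
  apply/seteqP; split=> w /= h.
    by move=> i _ r /h; rewrite /increments /increment !tnth_mktuple.
  move=> [i r] irJ; have := h i; rewrite inE => /(_ isT r irJ).
  by rewrite !tnth_mktuple.
rewrite X_indep //.
transitivity (\prod_(i in [set: 'I_N]%SET) \prod_(r | (i, r) \in J)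
    P (increments (i, r) @^-1` B (i, r))).
  apply: eq_bigr => i _.
  have <- : [set w | forall r, r \in [set r | (i, r) \in J]%SET ->
      B (i, r) (increment X i r w)] = sample_path X i @^-1` C i.
    apply/seteqP; split=> w /= h r.
      by move=> irJ; rewrite !tnth_mktuple; apply: h; rewrite inE.
    by rewrite inE => /h; rewrite !tnth_mktuple.
  rewrite (@incr_indep i _ (fun r => B (i, r))) => [|r]; last first.
    by rewrite inE; exact: mB.
  by apply: eq_bigl => r; rewrite inE.
rewrite pair_big_dep /=; apply: eq_big => [[i r]|[i r] _ //=].
by rewrite inE.
Qed.

(** Telescoping; this is where the processes are required to start at 0. *)
Lemma process_sum i m w : (m <= T)%N ->
  X i (inord m) w = (\sum_(r < T | (r < m)%N) increments (i, r) w)%R.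
Proof.
elim: m => [|m IHm] mT.
  rewrite big_pred0 // (_ : inord 0 = ord0) //.
  by apply/val_inj; rewrite /= inordK.
rewrite (bigD1 (Ordinal mT)) //=.
rewrite (eq_bigl (fun r : 'I_T => (r < m)%N)) => [|r]; last first.
  by rewrite -val_eqE /= ltnS [in RHS]ltn_neqAle andbC.
have -> : increments (i, Ordinal mT) w = (X i (inord m.+1) w - X i (inord m) w)%R.
  congr (X i _ w - X i _ w)%R; apply/val_inj; rewrite /= inordK //.
  by rewrite ltnS ltnW.
by rewrite -(IHm (ltnW mT)) subrK.
Qed.

Definition increments_in (a b : nat) : {set 'I_N * 'I_T} :=
  [set p : 'I_N * 'I_T | (a <= p.2 < b)%N]%SET.

Lemma measurable_increments_sum (a b : nat) (J : pred 'I_T) i :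
  (forall r, J r -> (a <= r < b)%N) ->
  measurable_fun setT
    ((fun w => (\sum_(r < T | J r) increments (i, r) w)%R)
     : g_sigma_algebraType (cylinders increments (increments_in a b)) -> R).
Proof.
move=> Jab; under eq_fun do rewrite big_mkcond /=.
apply: measurable_sum => r.
case Jr: (J r); last exact: measurable_cst.
by apply: cylinders_coordinate; rewrite inE /= Jab.
Qed.

Lemma measurable_past s :
  measurable_fun setT ((fun w => stopped s (realization X w))
     : g_sigma_algebraType (cylinders increments (increments_in 0 s)) -> _).
Proof.
apply: measurable_tuple_map => i; apply: measurable_tuple_map => u.
under eq_fun do rewrite tnth_realization process_sum ?geq_min -1?ltnS ?ltn_ord //.
by apply: measurable_increments_sum => r /=; rewrite leq_min => /andP[].
Qed.

Definition gains (s s' : nat) (w : Omega) : N.-tuple R :=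
  [tuple X i (inord s') w - X i (inord s) w | i < N]%R.

Lemma measurable_gains s s' : measurable_fun setT (gains s s').
Proof. by apply: measurable_tuple_map => i; exact: measurable_funB. Qed.

Lemma measurable_future s s' : (s <= s' <= T)%N ->
  measurable_fun setT (gains s s'
     : g_sigma_algebraType (cylinders increments (increments_in s s')) -> _).
Proof.
move=> /andP[ss' s'T]; apply: measurable_tuple_map => i.
rewrite (_ : (fun _ => _) = (fun w =>
    (\sum_(r < T | (s <= r < s')%N) increments (i, r) w)%R)).
  exact: measurable_increments_sum.
apply/funext => w; rewrite !process_sum //; last exact: leq_trans s'T.
rewrite (bigID (fun r : 'I_T => (r < s)%N)) /= addrC.
rewrite (eq_bigl (fun r : 'I_T => (s <= r < s')%N)) => [|r]; last first.
  by rewrite -leqNgt andbC.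
rewrite [X in (_ + X - _)%R](eq_bigl (fun r : 'I_T => (r < s)%N)) ?addrK // => r.
by rewrite andb_idl // => /leq_trans; apply.
Qed.

(** The paths stopped at [s] and the gains from [s] to [s'] are functions of
    disjoint blocks of increments. *)
Lemma past_future_independent s s' A B : (s <= s' <= T)%N ->
  measurable A -> measurable B ->
  P ((fun w => stopped s (realization X w)) @^-1` A `&` gains s s' @^-1` B) =
  P ((fun w => stopped s (realization X w)) @^-1` A) * P (gains s s' @^-1` B).
Proof.
move=> ss' mA mB.
apply: (independent_disjoint_blocks measurable_increments increments_independent
  (J := increments_in 0 s) (K := increments_in s s')).
- rewrite disjoint_subset; apply/fintype.subsetP => p; rewrite !inE /= => ps.
  by rewrite leqNgt ps.
- by have := @measurable_past s measurableT A mA; rewrite setTI.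
- by have := measurable_future ss' measurableT mB; rewrite setTI.
Qed.

Lemma gains_exchangeable s s' (p : {perm 'I_N}) (B : set (N.-tuple R)) :
  measurable B ->
  P [set w | B [tuple tnth (gains s s' w) (p i) | i < N]] =
  P [set w | B (gains s s' w)].
Proof.
move=> mB.
pose h (x : T.+1.-tuple R) := (tnth x (inord s') - tnth x (inord s))%R.
have mh : measurable_fun setT h by apply: measurable_funB; exact: measurable_tnth.
have gE w : gains s s' w = [tuple h (sample_path X i w) | i < N].
  by apply: eq_from_tnth => i; rewrite /h !tnth_mktuple.
rewrite (_ : [set w | B (gains s s' w)] =
    [set w | B [tuple h (sample_path X i w) | i < N]]); last first.
  by apply/seteqP; split=> w /=; rewrite gE.
rewrite -(@exchangeable_iid _ _ _ P N _ _ (fun i w => h (sample_path X i w)) p) //.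
- congr (P _); apply/funext => w; congr (B _).
  by apply: eq_from_tnth => i; rewrite gE !tnth_mktuple.
- by move=> i; apply: measurableT_comp => //; exact: measurable_sample_path.
- exact: mutually_independent_comp.
- exact: identically_distributed_comp.
Qed.

End processes.

(** * Dynamic programming *)

Section expected_utility.
Local Open Scope ereal_scope.
Context d (Omega : measurableType d) (R : realType) (P : probability Omega R).
Variables (N T : nat) (X : 'I_N -> 'I_T.+1 -> {RV P >-> R}).
Hypothesis X_indep : mutually_independent P (sample_path X).
Hypothesis X_ident : identically_distributed P (sample_path X).
Hypothesis X0 : forall (i : 'I_N) (w : Omega), X i ord0 w = 0%R.
Hypothesis incr_indep : forall i : 'I_N, mutually_independent P (increment X i).
Variables (k : nat) (t n : nat -> nat).
Hypothesis t_incr : forall j : nat, (j < k)%N -> (t j < t j.+1)%N.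
Hypothesis tk : t k = T.
Hypothesis nk : n k = 1%N.
Hypothesis k_gt0 : (0 < k)%N.
Variable phi : R -> \bar R.
Hypothesis mphi : measurable_fun setT phi.
Hypothesis phi_ge0 : forall r, 0 <= phi r.
Hypothesis phi_nd : forall r s : R, (r <= s)%R -> phi r <= phi s.

Let gain j := gains X (t j) (t j.+1).
Let V := optimal_value P n phi gain.
Let W := best_choice P n phi gain.

Let mgain j : measurable_fun setT (gain j).
Proof. exact: measurable_gains. Qed.

Let gain_exchangeable j (s : {perm 'I_N}) (B : set (N.-tuple R)) :
  measurable B ->
  P [set w | B [tuple tnth (gain j w) (s i) | i < N]] = P [set w | B (gain j w)].
Proof. exact: gains_exchangeable. Qed.

Lemma observation_time_le j : (j <= k)%N -> (t j <= T)%N.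
Proof.
have mono m : (j + m <= k)%N -> (t j <= t (j + m))%N.
  elim: m => [|m IHm]; rewrite ?addn0 // addnS => jmk.
  exact: leq_trans (IHm (ltnW jmk)) (ltnW (t_incr jmk)).
by move=> jk; have := mono (k - j)%N; rewrite subnKC // tk; exact.
Qed.

(** The optimal expected utility of continuing from the state that algorithm [f]
    has reached after stage [j]. *)
Let stage_value f j :=
  \int[P]_w V (k - j) j (selected t f (realization X w) j)
              (values_at (t j) (realization X w)).

(** The gains integrated out in the optimal value may be taken to be the actual
    ones, because they are independent of the state after stage [j]; added to the
    values at time [t j] they give the values at time [t j.+1]. *)
Lemma stage_valueE f j : iterative_selection k t n f -> (j < k)%N ->
  stage_value f j = \int[P]_w W (k - j.+1) j
    (selected t f (realization X w) j) (values_at (t j.+1) (realization X w)).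
Proof.
move=> [f_meas _] jk; rewrite /stage_value -(subnSK jk).
have tjT : (t j <= T)%N by apply: observation_time_le; exact: ltnW.
have tj1T : (t j <= t j.+1 <= T)%N by rewrite ltnW ?t_incr // observation_time_le.
pose h (z : N.-tuple (T.+1.-tuple R) * N.-tuple R) :=
  W (k - j.+1) j (selected t f z.1 j) (add_values (values_at (t j) z.1) z.2).
pose past w := stopped (t j) (realization X w).
have mpast : measurable_fun setT past.
  exact: (measurableT_comp (measurable_stopped _) (measurable_realization X)).
have mh : measurable_fun setT h.
  apply: (@measurable_fun_dispatch _ _ _ _ _
    (fun z : N.-tuple (T.+1.-tuple R) * N.-tuple R => selected t f z.1 j)
    (fun S z => W (k - j.+1) j S (add_values (values_at (t j) z.1) z.2))) => S.
    have := @measurable_fst _ _ (N.-tuple (T.+1.-tuple R)) (N.-tuple R) measurableT.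
    move=> /(_ _ (measurable_selected t f_meas S (ltnW jk))).
    by rewrite setTI.
  apply: measurableT_comp; first exact: measurable_best_choice.
  apply: measurable_add_values => //.
  exact: (measurableT_comp (measurable_values_at _)).
have sel_past w : selected t f (past w) j = selected t f (realization X w) j.
  by rewrite /selected (run_stopped f t_incr) // ltnW.
have val_past w : values_at (t j) (past w) = values_at (t j) (realization X w).
  by rewrite values_at_stopped.
have := integral_independent_pair mpast (mgain j)
  (fun A B mA mB => past_future_independent X_indep X0 incr_indep tj1T mA mB)
  mh (fun z => best_choice_ge0 _ _ _ _ _ _ _ _).
rewrite /h /= => h_indep.
transitivity (\int[P]_w \int[P]_w' h (past w, gain j w')).
  by apply: eq_integral => w _; rewrite /h /= sel_past val_past.
rewrite -h_indep; apply: eq_integral => w _; rewrite sel_past val_past.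
congr (W _ _ _ _); apply: eq_from_tnth => i.
by rewrite !tnth_mktuple addrC subrK.
Qed.

Lemma measurable_selected_values f j s (h : {set 'I_N} -> N.-tuple R -> \bar R) :
  iterative_selection k t n f -> (j <= k)%N ->
  (forall S, measurable_fun setT (h S)) ->
  measurable_fun setT (fun w =>
    h (selected t f (realization X w) j) (values_at s (realization X w))).
Proof.
move=> [f_meas _] jk mh.
apply: (measurableT_comp (f := fun x : N.-tuple (T.+1.-tuple R) =>
  h (selected t f x j) (values_at s x))); last exact: measurable_realization.
apply: (measurable_fun_dispatch (sel := fun x => selected t f x j)
  (h := fun S x => h S (values_at s x))) => S.
  exact: (measurable_selected t f_meas S jk).
exact: (measurableT_comp (mh S) (measurable_values_at s)).
Qed.

(** The selection actually made is one of the candidates of the best choice. *)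
Lemma stage_value_le f j : iterative_selection k t n f -> (j < k)%N ->
  stage_value f j.+1 <= stage_value f j.
Proof.
move=> f_alg jk; rewrite (stage_valueE f_alg jk).
apply: ge0_le_integral => //.
- by move=> w _; exact: optimal_value_ge0.
- apply: (measurable_selected_values _ (h := V (k - j.+1) j.+1) f_alg) => // S.
  exact: measurable_optimal_value.
- apply: (measurable_selected_values _ (h := W (k - j.+1) j) f_alg) => [|S].
    exact: ltnW.
  exact: measurable_best_choice.
move=> w _; have [sub card] := f_alg.2 (realization X w) j jk.
by apply: le_bigmax_cond; rewrite sub card eqxx.
Qed.

(** The greedy selection attains the maximum of the best choice. *)
Lemma stage_value_greedy g j : greedy_selection k t n g -> (j < k)%N ->
  stage_value g j.+1 = stage_value g j.
Proof.
move=> [g_alg g_high] jk; apply/le_anti; rewrite stage_value_le //=.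
rewrite (stage_valueE g_alg jk).
apply: ge0_le_integral => //.
- by move=> w _; exact: best_choice_ge0.
- apply: (measurable_selected_values _ (h := W (k - j.+1) j) g_alg) => [|S].
    exact: ltnW.
  exact: measurable_best_choice.
- apply: (measurable_selected_values _ (h := V (k - j.+1) j.+1) g_alg) => // S.
  exact: measurable_optimal_value.
move=> w _; apply: bigmax_le => [|A /andP[AS /eqP cA]].
  exact: optimal_value_ge0.
apply: (optimal_value_highest n mphi phi_nd mgain gain_exchangeable _ _ _ AS cA).
have -> : tnth (values_at (t j.+1) (realization X w)) =
    (fun i => tnth (tnth (realization X w) i) (inord (t j.+1))).
  by apply/funext => i; rewrite tnth_mktuple.
exact: g_high.
Qed.

Lemma stage_value_final f : iterative_selection k t n f ->
  stage_value f k = \int[P]_w phi (alg_value k t f (realization X w)).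
Proof.
move=> [_ f_sel]; apply: eq_integral => w _; set x := realization X w.
have k1k : (k.-1 < k)%N by rewrite prednK.
have [_] := f_sel x _ k1k; rewrite prednK // nk => /eqP/cards1P[i Si].
rewrite subnn /V /= /alg_value Si.
case: pickP => [i'|/(_ i)]; last by rewrite inE eqxx.
rewrite inE => /eqP->.
have <- : tnth (values_at (t k) x) i = tnth (tnth x i) ord_max.
  rewrite tnth_mktuple tk; congr tnth.
  by apply/val_inj; rewrite /= inordK.
apply/le_anti/andP; split.
  by apply: bigmax_le => // i''; rewrite inE => /eqP->.
by apply: (@le_bigmax_cond _ _ _ _ i); rewrite inE.
Qed.

(** Both algorithms have the same value at stage 0, where all the processes are
    retained and nothing has been selected. *)
Theorem greedy_maximizes_expected_utility f g :
  iterative_selection k t n f -> greedy_selection k t n g ->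
  \int[P]_w phi (alg_value k t f (realization X w)) <=
  \int[P]_w phi (alg_value k t g (realization X w)).
Proof.
move=> f_alg g_greedy; have [g_alg _] := g_greedy.
rewrite -(stage_value_final f_alg) -(stage_value_final g_alg).
have f_le j : (j <= k)%N -> stage_value f j <= stage_value f 0.
  elim: j => // j IHj jk.
  exact: le_trans (stage_value_le f_alg jk) (IHj (ltnW jk)).
have g_eq j : (j <= k)%N -> stage_value g j = stage_value g 0.
  elim: j => // j IHj jk.
  by rewrite (stage_value_greedy g_greedy jk) IHj // ltnW.
by rewrite g_eq // f_le.
Qed.

End expected_utility.

(** * From tail probabilities to expectations *)

(** The positive and negative parts have the tails of [Y] on their half-lines.
    The identity holds in the extended reals, by the definition of the integral
    as the difference of the integrals of these parts. *)
Lemma expectation_tails d (Omega : measurableType d) (R : realType)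
    (P : probability Omega R) (Y : {RV P >-> R}) :
  ('E_P[Y] = \int[lebesgue_measure]_(r in `[0%R, +oo[) ccdf Y r -
             \int[lebesgue_measure]_(r in `]-oo, 0%R[) cdf Y r)%E.
Proof.
have <- : (\int[P]_w (EFin \o Y)^\+ w =
    \int[lebesgue_measure]_(r in `[0%R, +oo[) ccdf Y r)%E.
  transitivity ('E_P[(Y^\+)%R])%E; first by rewrite expectation_def funerpos.
  rewrite ge0_expectation_ccdf; last exact: funrpos_ge0.
  apply: eq_integral => r; rewrite inE /= in_itv /= andbT => r0.
  congr (P _); apply/seteqP; split=> w /=; rewrite !in_itv /= !andbT /funrpos /=;
    by rewrite lt_max (ltNge r 0) r0 orbF.
have <- : (\int[P]_w (EFin \o Y)^\- w =
    \int[lebesgue_measure]_(r in `]-oo, 0%R[) cdf Y r)%E.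
  have Yneg_le0 w : ((- Y^\-%R) w <= 0)%R by rewrite oppr_le0 funrneg_ge0.
  rewrite -[RHS]oppeK.
  transitivity (- 'E_P[(- Y^\-)%R])%E.
    rewrite funerneg expectation_def -[LHS]oppeK -integral_ge0N => [//|w _].
    by rewrite lee_fin funrneg_ge0.
  rewrite le0_expectation_cdf //; congr (- - _)%E.
  apply: eq_integral => r; rewrite inE /= in_itv /= => r0.
  congr (P _); apply/seteqP; split=> w /=; rewrite !in_itv /= /funrneg /=;
    by rewrite lerNl le_max lerN2 (leNgt _ 0) oppr_gt0 r0 orbF.
by rewrite expectation_def; exact: integralE.
Qed.

Lemma expectation_le_ccdf d (Omega : measurableType d) (R : realType)
    (P : probability Omega R) (U V : {RV P >-> R}) :
  (forall r, (ccdf U r <= ccdf V r)%E) -> ('E_P[U] <= 'E_P[V])%E.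
Proof.
move=> UV.
have cdfVU r : (cdf V r <= cdf U r)%E.
  by rewrite !cdf_1_ccdf; exact: leeB.
rewrite !expectation_tails leeB // ge0_le_integral //.
- by apply: measurable_funTS; exact: ccdf_measurable.
- by apply: measurable_funTS; exact: ccdf_measurable.
- by apply: measurable_funTS; exact: cdf_measurable.
- by apply: measurable_funTS; exact: cdf_measurable.
Qed.

Lemma measurable_alg_value (R : realType) (N T k : nat) (t n : nat -> nat)
    (f : nat -> history R N T -> {set 'I_N}) :
  iterative_selection k t n f -> measurable_fun setT (alg_value k t f).
Proof.
move=> [f_meas _].
apply: (measurable_fun_dispatch (sel := fun x => selected t f x k)
  (h := fun A x => if [pick i in A] is Some i then tnth (tnth x i) ord_max else 0)).
  by move=> A; exact: (measurable_selected t f_meas A (leqnn k)).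
move=> A; case: pickP => [i _|_]; last exact: measurable_cst.
exact: (measurableT_comp (@measurable_tnth _ _ _ _) (@measurable_tnth _ _ _ _)).
Qed.

(** * Optimality of the greedy selection *)

Theorem theorem4p1 (d : measure_display) (Omega : measurableType d)
  (R : realType) (P : probability Omega R) (N T : nat)
  (X : 'I_N -> 'I_T.+1 -> {RV P >-> R})
  (X_indep : mutually_independent P (sample_path X))
  (X_ident : identically_distributed P (sample_path X))
  (X0 : forall (i : 'I_N) (w : Omega), X i ord0 w = 0)
  (incr_indep : forall i : 'I_N, mutually_independent P (increment X i))
  (k : nat) (t n : nat -> nat)
  (k_gt0 : (0 < k)%N)
  (t0 : t 0%N = 0%N)
  (t_incr : forall j : nat, (j < k)%N -> (t j < t j.+1)%N)
  (tk : t k = T)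
  (n0 : n 0%N = N)
  (n_decr : forall j : nat, (j < k)%N -> (n j.+1 < n j)%N)
  (nk : n k = 1%N)
  (f g : nat -> history R N T -> {set 'I_N})
  (f_alg : iterative_selection k t n f)
  (g_greedy : greedy_selection k t n g)
  (f_exp : has_expectation P (fun w => alg_value k t f (realization X w)))
  (g_exp : has_expectation P (fun w => alg_value k t g (realization X w))) :
  ('E_P[fun w => alg_value k t f (realization X w)] <=
   'E_P[fun w => alg_value k t g (realization X w)])%E.
Proof.
have malg f' : iterative_selection k t n f' ->
    measurable_fun setT (fun w => alg_value k t f' (realization X w)).
  move=> f'_alg; apply: measurableT_comp; last exact: measurable_realization.
  exact: measurable_alg_value f'_alg.
pose Y f' (f'_alg : iterative_selection k t n f') : {RV P >-> R} :=
  mfun_Sub (mem_set (malg f' f'_alg)).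
apply: (@expectation_le_ccdf _ _ _ _ (Y f f_alg) (Y g g_greedy.1)) => r.
have ccdfE f' (f'_alg : iterative_selection k t n f') : (ccdf (Y f' f'_alg) r =
    \int[P]_w (\1_(`]r, +oo[ : set R) (alg_value k t f' (realization X w)))%:E)%E.
  transitivity (\int[P]_w (\1_(Y f' f'_alg @^-1` `]r, +oo[) w)%:E)%E => //.
  by rewrite integral_indic ?setIT //; exact: measurable_funPTI.
rewrite !ccdfE.
apply: (greedy_maximizes_expected_utility X_indep X_ident X0 incr_indep t_incr
  tk nk k_gt0 (phi := fun x => (\1_(`]r, +oo[ : set R) x)%:E)) => //.
- by apply/measurable_EFinP; exact: measurable_indic.
- move=> x y xy; rewrite /= lee_fin !indicE ler_nat.
  case: (boolP (x \in _)) => //; rewrite inE /= in_itv /= andbT => rx.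
  by rewrite mem_set //= in_itv /= andbT (lt_le_trans rx xy).
Qed.
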